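(* An idempotent semiring $S$ is a band semiring if and only if it is a spined product of a left band semiring and a right band semiring with respect to a distributive lattice.
   Context: A semiring $(S,+,\cdot)$ is a set with two associative binary operations such that $x(y+z)=xy+xz$ and $(x+y)z=xz+yz$ (no commutativity assumed). An idempotent semiring is a semiring satisfying $x+x=x$ and $x\cdot x=x$. A band semiring is an idempotent semiring satisfying $x+xy+x=x$ and $x+yx+x=x$. A left [right] band semiring is an idempotent semiring on which Green's relation $\mathcal{L}^+$ [$\mathcal{R}^+$] of the additive reduct is the least distributive lattice congruence; equivalently, an idempotent semiring satisfying $x=x+yxy$ [$x=yxy+x$]. A distributive lattice is regarded as a semiring (join as $+$, meet as $\cdot$). A semiring $S$ is a spined product of semirings $S_1$ and $S_2$ with respect to a semiring $T$ if there are surjective semiring homomorphisms $\phi_1:S_1\to T$ and $\phi_2:S_2\to T$ such that $S$ is isomorphic to the subsemiring $\{(a,b)\in S_1\times S_2\mid \phi_1(a)=\phi_2(b)\}$ of $S_1\times S_2$. *)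

(* Defs.v *)
From mathcomp Require Import all_boot all_order boolp.

Import Order.Theory.

Set Implicit Arguments.
Unset Strict Implicit.
Unset Printing Implicit Defensive.

(* Neither operation is assumed commutative, and there is no zero or unit, so
   the semirings of the algebra library do not apply. *)
Record semiring := Semiring {
  carrier :> Type;
  add : carrier -> carrier -> carrier;
  mul : carrier -> carrier -> carrier;
  addA : associative add;
  mulA : associative mul;
  mulDr : right_distributive mul add;
  mulDl : left_distributive mul add }.

Declare Scope semiring_scope.
Delimit Scope semiring_scope with sr.
Notation "x + y" := (add x y) : semiring_scope.
Notation "x * y" := (mul x y) : semiring_scope.
Local Open Scope semiring_scope.

Record hom (S T : semiring) := Hom {
  hom_fun :> S -> T;
  homD : {morph hom_fun : x y / x + y};
  homM : {morph hom_fun : x y / x * y} }.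

Definition isomorphic (S T : semiring) : Prop :=
  exists f : hom S T, bijective f.

Definition surjective (A B : Type) (f : A -> B) : Prop :=
  forall y, exists x, f x = y.

Section Product.
Variables S1 S2 : semiring.

Definition prod_add (p q : S1 * S2) : S1 * S2 := (p.1 + q.1, p.2 + q.2).
Definition prod_mul (p q : S1 * S2) : S1 * S2 := (p.1 * q.1, p.2 * q.2).

Fact prod_addA : associative prod_add.
Proof. by move=> p q r; rewrite /prod_add /= !addA. Qed.
Fact prod_mulA : associative prod_mul.
Proof. by move=> p q r; rewrite /prod_mul /= !mulA. Qed.
Fact prod_mulDr : right_distributive prod_mul prod_add.
Proof. by move=> p q r; rewrite /prod_mul /prod_add /= !mulDr. Qed.
Fact prod_mulDl : left_distributive prod_mul prod_add.
Proof. by move=> p q r; rewrite /prod_mul /prod_add /= !mulDl. Qed.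

Definition prod_semiring : semiring :=
  Semiring prod_addA prod_mulA prod_mulDr prod_mulDl.
End Product.

Section Subsemiring.
Variables (S : semiring) (P : S -> Prop).
Hypothesis PD : forall x y, P x -> P y -> P (x + y).
Hypothesis PM : forall x y, P x -> P y -> P (x * y).

Definition sub_add (u v : {x | P x}) : {x | P x} :=
  exist P (sval u + sval v) (PD (svalP u) (svalP v)).
Definition sub_mul (u v : {x | P x}) : {x | P x} :=
  exist P (sval u * sval v) (PM (svalP u) (svalP v)).

Fact sub_addA : associative sub_add.
Proof. by move=> u v w; apply: eq_exist => /=; rewrite addA. Qed.
Fact sub_mulA : associative sub_mul.
Proof. by move=> u v w; apply: eq_exist => /=; rewrite mulA. Qed.
Fact sub_mulDr : right_distributive sub_mul sub_add.
Proof. by move=> u v w; apply: eq_exist => /=; rewrite mulDr. Qed.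
Fact sub_mulDl : left_distributive sub_mul sub_add.
Proof. by move=> u v w; apply: eq_exist => /=; rewrite mulDl. Qed.

Definition sub_semiring : semiring :=
  Semiring sub_addA sub_mulA sub_mulDr sub_mulDl.
End Subsemiring.

Section Pullback.
Variables (S1 S2 T : semiring) (phi1 : hom S1 T) (phi2 : hom S2 T).

Definition in_pullback (p : prod_semiring S1 S2) : Prop := phi1 p.1 = phi2 p.2.

Fact in_pullbackD p q : in_pullback p -> in_pullback q -> in_pullback (p + q).
Proof. by rewrite /in_pullback /= !homD => -> ->. Qed.
Fact in_pullbackM p q : in_pullback p -> in_pullback q -> in_pullback (p * q).
Proof. by rewrite /in_pullback /= !homM => -> ->. Qed.

Definition pullback : semiring := sub_semiring in_pullbackD in_pullbackM.
End Pullback.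

Definition spined_product (S S1 S2 T : semiring) : Prop :=
  exists (phi1 : hom S1 T) (phi2 : hom S2 T),
    [/\ surjective phi1, surjective phi2 & isomorphic S (pullback phi1 phi2)].

Record is_congruence (S : semiring) (rho : S -> S -> Prop) : Prop :=
  IsCongruence {
    congr_refl : forall x, rho x x;
    congr_sym : forall x y, rho x y -> rho y x;
    congr_trans : forall y x z, rho x y -> rho y z -> rho x z;
    congrD : forall x x' y y', rho x x' -> rho y y' -> rho (x + y) (x' + y');
    congrM : forall x x' y y', rho x x' -> rho y y' -> rho (x * y) (x' * y') }.

Section Quotient.
Variables (S : semiring) (rho : S -> S -> Prop) (rhoP : is_congruence rho).

Local Open Scope quotient_scope.

(* {classic S} is S with the choice structure that generic quotients need. *)
Definition congr_rel : rel {classic S} := fun x y => `[< rho x y >].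

Fact congr_rel_refl : reflexive congr_rel.
Proof. by move=> x; apply/asboolP/(congr_refl rhoP). Qed.
Fact congr_rel_sym : symmetric congr_rel.
Proof.
by move=> x y; apply/idP/idP => /asboolP xy; apply/asboolP/(congr_sym rhoP).
Qed.
Fact congr_rel_trans : transitive congr_rel.
Proof.
move=> y x z /asboolP xy /asboolP yz.
by apply/asboolP/(congr_trans rhoP xy yz).
Qed.

Definition congr_equiv : equiv_rel {classic S} :=
  EquivRel congr_rel congr_rel_refl congr_rel_sym congr_rel_trans.

Definition quot : Type := {eq_quot congr_equiv}.

Definition class_of (x : S) : quot := \pi_{eq_quot congr_equiv} (x : {classic S}).
Definition class_repr (u : quot) : S := repr (u : {eq_quot congr_equiv}).

Fact class_reprK u : class_of (class_repr u) = u.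
Proof. exact: reprK. Qed.
Fact class_ofP x y : class_of x = class_of y <-> rho x y.
Proof. by split=> [/eqmodP/asboolP | xy] //; apply/eqmodP/asboolP. Qed.

Definition quot_add (u v : quot) : quot :=
  class_of (class_repr u + class_repr v).
Definition quot_mul (u v : quot) : quot :=
  class_of (class_repr u * class_repr v).

Fact class_ofD x y : class_of (x + y) = quot_add (class_of x) (class_of y).
Proof.
by apply/class_ofP/(congrD rhoP); apply/class_ofP; rewrite class_reprK.
Qed.
Fact class_ofM x y : class_of (x * y) = quot_mul (class_of x) (class_of y).
Proof.
by apply/class_ofP/(congrM rhoP); apply/class_ofP; rewrite class_reprK.
Qed.

Fact quot_addA : associative quot_add.
Proof.
move=> u v w; rewrite -(class_reprK u) -(class_reprK v) -(class_reprK w).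
by rewrite -!class_ofD addA.
Qed.
Fact quot_mulA : associative quot_mul.
Proof.
move=> u v w; rewrite -(class_reprK u) -(class_reprK v) -(class_reprK w).
by rewrite -!class_ofM mulA.
Qed.
Fact quot_mulDr : right_distributive quot_mul quot_add.
Proof.
move=> u v w; rewrite -(class_reprK u) -(class_reprK v) -(class_reprK w).
by rewrite -!(class_ofM, class_ofD) mulDr.
Qed.
Fact quot_mulDl : left_distributive quot_mul quot_add.
Proof.
move=> u v w; rewrite -(class_reprK u) -(class_reprK v) -(class_reprK w).
by rewrite -!(class_ofM, class_ofD) mulDl.
Qed.

Definition quot_semiring : semiring :=
  Semiring quot_addA quot_mulA quot_mulDr quot_mulDl.
End Quotient.

Definition lattice_semiring (d : Order.disp_t) (L : distrLatticeType d) :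
    semiring :=
  @Semiring L Order.join Order.meet
    (@joinA d L) (@meetA d L) (@meetUr d L) (@meetUl d L).

Definition is_distributive_lattice (T : semiring) : Prop :=
  exists (d : Order.disp_t) (L : distrLatticeType d),
    isomorphic T (lattice_semiring L).

Definition distributive_lattice_congruence (S : semiring)
    (rho : S -> S -> Prop) : Prop :=
  exists rhoP : is_congruence rho, is_distributive_lattice (quot_semiring rhoP).

Definition least_distributive_lattice_congruence (S : semiring)
    (rho : S -> S -> Prop) : Prop :=
  distributive_lattice_congruence rho /\
  forall sigma : S -> S -> Prop, distributive_lattice_congruence sigma ->
    forall x y, rho x y -> sigma x y.

(* The principal one-sided ideals S^1 + a and a + S^1 of (S, +). *)
Definition add_left_ideal (S : semiring) (a x : S) : Prop :=
  x = a \/ exists s, x = s + a.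
Definition add_right_ideal (S : semiring) (a x : S) : Prop :=
  x = a \/ exists s, x = a + s.

Definition green_L_add (S : semiring) (a b : S) : Prop :=
  forall x, add_left_ideal a x <-> add_left_ideal b x.
Definition green_R_add (S : semiring) (a b : S) : Prop :=
  forall x, add_right_ideal a x <-> add_right_ideal b x.

Definition idempotent_semiring (S : semiring) : Prop :=
  (forall x : S, x + x = x) /\ (forall x : S, x * x = x).

Definition band_semiring (S : semiring) : Prop :=
  [/\ idempotent_semiring S,
      forall x y : S, x + x * y + x = x
    & forall x y : S, x + y * x + x = x].

Definition left_band_semiring (S : semiring) : Prop :=
  idempotent_semiring S /\
  least_distributive_lattice_congruence (@green_L_add S).

Definition right_band_semiring (S : semiring) : Prop :=
  idempotent_semiring S /\
  least_distributive_lattice_congruence (@green_R_add S).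

(* Main.v *)
From HB Require Import structures.
From mathcomp Require Import all_boot all_order boolp.
Require Import Defs.

(** Write x D y for Green's relation of the additive band (S, +), so that x D y
    means x + y + x = x and y + x + y = y.

    If S is a band semiring, D is a congruence, and in S/D the absorption laws
    x + x y = x = x + y x make the product a meet; so S/D is a distributive
    lattice, and D is the least congruence with such a quotient because
    D-related elements coincide in every quotient with commutative idempotent
    sums.  The crux is that L and R (Green's relations of (S, +))
    are also semiring congruences, i.e. that (S, +) is a regular band.  Only
    the compatibility of L with sums on the left is not automatic; it follows
    from [green_L_addl_eq]: if a L b and c absorbs a, then a, b and all
    products of one of them with c are in one D-class, which is a rectangular
    band, and the two ways of expanding (c + a)(c + b) evaluate to c + a and to
    c + b.  Statements about R are those about L in the semiring with reversed
    addition.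

    Then S/R satisfies x + y + x = x + y, so L and D coincide on it and it is a
    left band semiring; symmetrically S/L is a right one.  The map
    x |-> ([x]_R, [x]_L) is injective since L and R meet in equality, and
    its image is the pullback over S/D: if x D y, then x + y is R-related to x
    and L-related to y.

    Conversely, L and R are finer than D, and if some congruence finer than D
    has a distributive lattice as quotient, then x D x + x y and x D x + y x,
    which are the band identities.  Identities pass to pullbacks. *)

Set Implicit Arguments.
Unset Strict Implicit.
Unset Printing Implicit Defensive.

Import Order.LTheory.
Local Open Scope semiring_scope.

(** * The additive band of an idempotent semiring *)

(** The J-order of the band (S, +), reversed so that sums are suprema. *)
Definition absorbs (S : semiring) (x z : S) : Prop := x + z + x = x.

Definition green_D_add (S : semiring) (x y : S) : Prop :=
  absorbs x y /\ absorbs y x.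

Section AdditiveBand.
Variable S : semiring.
Hypothesis idem : idempotent_semiring S.
Implicit Types a b c p q u v x y z : S.

Lemma addxx x : x + x = x. Proof. by case: idem. Qed.
Lemma mulxx x : x * x = x. Proof. by case: idem. Qed.

Lemma addKl x y : x + (x + y) = x + y. Proof. by rewrite addA addxx. Qed.
Lemma addK2 x y : x + (y + (x + y)) = x + y.
Proof. by rewrite addA addxx. Qed.

Lemma absorbs_refl x : absorbs x x.
Proof. by rewrite /absorbs !addxx. Qed.

(** Idempotency of p + z + q + z, multiplied by q on the right. *)
Lemma absorbs_factor p z q : absorbs (p + z + q) z.
Proof.
rewrite /absorbs.
have zq : z + q + z + q = z + q by rewrite -addA addxx.
have := congr1 (fun t => t + q) (addxx (p + z + q + z)).
rewrite -(addA _ _ q) -!addA; rewrite -!addA in zq.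
by rewrite !zq.
Qed.

Lemma absorbs_addl x y : absorbs (x + y) x.
Proof. by have := absorbs_factor x x y; rewrite addxx. Qed.

Lemma absorbs_addr x y : absorbs (x + y) y.
Proof. by have := absorbs_factor x y y; rewrite -addA addxx. Qed.

(** x = (x + y) + z + (y + x) contains z as a summand. *)
Lemma absorbs_trans y x z : absorbs x y -> absorbs y z -> absorbs x z.
Proof.
move=> xy yz; have := absorbs_factor (x + y) z (y + x).
suff -> : x + y + z + (y + x) = x by [].
by rewrite -[RHS]xy -[in RHS]yz !addA.
Qed.

(** Absorbing u + v is less obvious than absorbing v + x + u; the latter is
    turned into a sum containing u + v by squaring it. *)
Lemma absorbs_add x u v : absorbs x u -> absorbs x v -> absorbs x (u + v).
Proof.
move=> xu xv; apply: (@absorbs_trans (v + x + u)).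
  have := absorbs_factor x (v + x + u) x.
  suff -> : x + (v + x + u) + x = x by [].
  by rewrite -[RHS]xu -[X in _ = X + u + x]xv !addA.
have := absorbs_factor (v + x) (u + v) (x + u).
suff -> : v + x + (u + v) + (x + u) = v + x + u by [].
by rewrite -[RHS]addxx !addA.
Qed.

Lemma absorbs_mul x x' u u' :
  absorbs x u -> absorbs x' u' -> absorbs (x * x') (u * u').
Proof.
move=> xu xu'; apply: (@absorbs_trans (u * x')).
  by rewrite /absorbs -!mulDl xu.
by rewrite /absorbs -!mulDr xu'.
Qed.

Lemma green_D_refl x : green_D_add x x.
Proof. by split; apply: absorbs_refl. Qed.

Lemma green_D_sym x y : green_D_add x y -> green_D_add y x.
Proof. by case. Qed.

Lemma green_D_trans y x z :
  green_D_add x y -> green_D_add y z -> green_D_add x z.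
Proof.
move=> [xy yx] [yz zy].
by split; [apply: absorbs_trans yz | apply: absorbs_trans yx].
Qed.

Lemma green_D_congruence : is_congruence (@green_D_add S).
Proof.
split; [exact: green_D_refl | exact: green_D_sym | exact: green_D_trans | |].
- have half x x' y y' :
      absorbs x x' -> absorbs y y' -> absorbs (x + y) (x' + y').
    move=> xx' yy'; apply: absorbs_add.
      exact: absorbs_trans (absorbs_addl x y) xx'.
    exact: absorbs_trans (absorbs_addr x y) yy'.
  by move=> x x' y y' [? ?] [? ?]; split; apply: half.
- by move=> x x' y y' [? ?] [? ?]; split; apply: absorbs_mul.
Qed.

Lemma green_D_addC x y : green_D_add (x + y) (y + x).
Proof.
by split; apply: absorbs_add; (apply: absorbs_addl || apply: absorbs_addr).
Qed.

(** The D-classes of (S, +) are rectangular bands. *)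
Lemma green_D_rectangular x y z :
  green_D_add x y -> green_D_add x z -> x + y + z = x + z.
Proof.
move=> [xy _] [xz zx].
have xyz := absorbs_add xy xz.
by rewrite -[in RHS]xyz -[in LHS]zx !addA.
Qed.

Lemma green_L_addP a b : green_L_add a b <-> a + b = a /\ b + a = b.
Proof.
have ideal x y : add_left_ideal x y <-> y + x = y.
  split=> [[->|[s ->]]|yx]; first exact: addxx.
    by rewrite -addA addxx.
  by right; exists y.
split=> [ab|[ab ba] x].
  by split; apply/ideal; [apply/(ab a) | apply/(ab b)]; left.
by split=> /ideal xy; apply/ideal; rewrite -xy -addA ?ab ?ba.
Qed.

Lemma green_L_sub_D a b : green_L_add a b -> green_D_add a b.
Proof.
by case/green_L_addP=> ab ba; split; rewrite /absorbs ?ab ?ba addxx.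
Qed.

End AdditiveBand.

(** * Reversal of addition *)

Section Reversal.
Variable S : semiring.

Definition rev_add (x y : S) : S := y + x.

Fact rev_addA : associative rev_add.
Proof. by move=> x y z; rewrite /rev_add addA. Qed.
Fact rev_mulDr : right_distributive (@mul S) rev_add.
Proof. by move=> x y z; rewrite /rev_add mulDr. Qed.
Fact rev_mulDl : left_distributive (@mul S) rev_add.
Proof. by move=> x y z; rewrite /rev_add mulDl. Qed.

(** Green's relation R of S is convertible to L of this semiring. *)
Definition rev_semiring : semiring :=
  Semiring rev_addA (@mulA S) rev_mulDr rev_mulDl.

Lemma rev_band : band_semiring S -> band_semiring rev_semiring.
Proof.
case=> idem xxy xyx; split; first exact: idem.
- by move=> x y; rewrite /= /rev_add addA xxy.
- by move=> x y; rewrite /= /rev_add addA xyx.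
Qed.

Hypothesis idem : idempotent_semiring S.

Lemma green_R_addP (a b : S) : green_R_add a b <-> b + a = a /\ a + b = b.
Proof. exact: (@green_L_addP rev_semiring idem). Qed.

Lemma green_R_sub_D (a b : S) : green_R_add a b -> green_D_add a b.
Proof.
case/green_R_addP=> ba ab.
by split; rewrite /absorbs ?ab ?ba -?addA ?ab ?ba ?addxx.
Qed.

End Reversal.

(** * Green's relations of a band semiring are congruences *)

Section BandCongruences.
Variable S : semiring.
Hypothesis band : band_semiring S.
Implicit Types a b c x y : S.

Let idem : idempotent_semiring S. Proof. by case: band. Qed.

Lemma absorbs_mulr x y : absorbs x (x * y).
Proof. by case: band => _ xy _; apply: xy. Qed.

Lemma absorbs_mull x y : absorbs x (y * x).
Proof. by case: band => _ _ yx; apply: yx. Qed.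

Lemma green_D_mulr a c : absorbs c a -> green_D_add a (a * c).
Proof.
move=> ca; split; first exact: absorbs_mulr.
by have := absorbs_mul idem (absorbs_refl idem a) ca; rewrite mulxx.
Qed.

Lemma green_D_mull a c : absorbs c a -> green_D_add a (c * a).
Proof.
move=> ca; split; first exact: absorbs_mull.
by have := absorbs_mul idem ca (absorbs_refl idem a); rewrite mulxx.
Qed.

(** This is where multiplication forces (S, +) to be regular.  In a band alone
    it can fail; here the product (c + a)(c + b) links the two sums, since a c,
    c a, b c, c b and a b all fall into the rectangular band formed by the
    D-class of a. *)
Lemma green_L_addl_eq a b c : absorbs c a -> green_L_add a b -> c + a = c + b.
Proof.
move=> ca Lab; have [ab ba] := (green_L_addP idem a b).1 Lab.
have Dab := green_L_sub_D idem Lab.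
have cb : absorbs c b := absorbs_trans idem ca Dab.1.
have toa x y : green_D_add a x -> green_D_add a y -> green_D_add x y.
  by move=> /green_D_sym; apply: green_D_trans.
have [Da Dac Dca] : [/\ green_D_add a a, green_D_add a (a * c)
    & green_D_add a (c * a)].
  by split; [exact: green_D_refl | exact: green_D_mulr | exact: green_D_mull].
have [Dbc Dcb] : green_D_add a (b * c) /\ green_D_add a (c * b).
  split; apply: (green_D_trans idem Dab).
    exact: green_D_mulr.
  exact: green_D_mull.
have Dab2 : green_D_add a (a * b).
  by have := congrM (green_D_congruence idem) Da Dab; rewrite mulxx.
have rect x y z : green_D_add a x -> green_D_add a y -> green_D_add a z ->
    x + y + z = x + z.
  by move=> ax ay az; apply: green_D_rectangular => //; apply: toa.
have a_ab : a + a * b = a by rewrite -{1}(mulxx idem a) -mulDr ab mulxx.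
have b_ab : b + a * b = b by rewrite -{1}(mulxx idem b) -mulDl ba mulxx.
(* The squares of the two factors and their product expand to c plus a sum in
   the D-class of a, which depends only on its first and last terms.  The inner
   products are ordered so that these first terms agree. *)
transitivity ((c + a) * (c + b)).
  rewrite -[LHS](mulxx idem) !(mulDr (c + a)) !mulDl !(mulxx idem) -!addA.
  congr (c + _); rewrite !addA !rect //.
  by rewrite -(rect (a * c) a (a * b)) // -addA a_ab.
rewrite -[RHS](mulxx idem) !mulDl !mulDr !(mulxx idem) -!addA.
congr (c + _); rewrite !addA !rect //.
by rewrite -(rect (c * b) b (a * b)) // -addA b_ab.
Qed.

Lemma green_L_congruence : is_congruence (@green_L_add S).
Proof.
have LP := green_L_addP idem.
have Ltrans y x z : green_L_add x y -> green_L_add y z -> green_L_add x z.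
  by move=> xy yz t; rewrite (xy t).
split=> //.
- by move=> x y xy z; rewrite (xy z).
- have addr x x' y : green_L_add x x' -> green_L_add (x + y) (x' + y).
    case/LP=> xx' x'x; apply/LP; split.
      by rewrite -{1}xx' -!addA addK2 // addA xx'.
    by rewrite -{1}x'x -!addA addK2 // addA x'x.
  (* x need not absorb y, but x + y + x does, and x + y + x + y = x + y. *)
  have addl_half x y y' : green_L_add y y' -> x + y + (x + y') = x + y.
    move=> yy'.
    have := green_L_addl_eq (absorbs_factor idem x y x) yy'.
    by rewrite -!addA addK2 // => <-.
  move=> x x' y y' xx' yy'; apply: Ltrans (addr _ _ _ xx') _.
  apply/LP; split; apply: addl_half => //.
  by move=> z; rewrite (yy' z).
- move=> x x' y y' /LP[xx' x'x] /LP[yy' y'y].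
  apply: (Ltrans (x' * y)); apply/LP; split; rewrite -?mulDl -?mulDr.
  all: by rewrite ?xx' ?x'x ?yy' ?y'y.
Qed.

End BandCongruences.

Lemma green_R_congruence (S : semiring) :
  band_semiring S -> is_congruence (@green_R_add S).
Proof.
move/rev_band/green_L_congruence=> [rxx rC rtr rD rM]; split=> //.
by move=> x x' y y' xx' yy'; apply: (rD y y' x x').
Qed.

(** * Distributive lattice quotients *)

(** What remains to be shown is that the product commutes.  In the order of the
    join semilattice (T, +), products are monotone, so that absorption and
    idempotency make x y a greatest lower bound. *)
Lemma distributive_lattice_of_absorption (T : semiring) :
  idempotent_semiring T -> commutative (@add T) ->
  (forall x y : T, x + x * y = x) -> (forall x y : T, x + y * x = x) ->
  is_distributive_lattice T.
Proof.
move=> [addid mulid] addC absr absl.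
have mul_le (x y : T) : x * y + y * x = y * x.
  (* Both summands lie below x and y, hence so does their sum s, and s = s s
     lies below y x. *)
  set s := x * y + y * x.
  have ys : y + s = y by rewrite /s addA absl absr.
  have xs : x + s = x by rewrite /s addA absr absl.
  have yxs : y * x + s = y * x.
    have H : y * x + s * x = y * x by rewrite -mulDl ys.
    have sxs : s * x + s = s * x by rewrite -{2}(mulid s) -mulDr xs.
    by rewrite -{1}H -addA sxs H.
  by rewrite -[RHS]yxs addC /s -addA addid.
have mulC : commutative (@mul T).
  by move=> x y; rewrite -(mul_le x y) addC mul_le.
have joinKI (y x : T) : x * (x + y) = x by rewrite mulDr mulid absr.
pose d : Order.disp_t := Order.Disp tt tt.
pose mixin := @Order.isMeetJoinDistrLattice.Build d {classic T}
  (fun x y => mul x y == x :> {classic T})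
  (fun x y => (y != x) && (mul x y == x :> {classic T}))
  (@mul T) (@add T) (fun _ _ => erefl) (fun _ _ => erefl)
  mulC addC (@mulA T) (@addA T) joinKI (fun y x => absr x y) (@mulDl T) mulid.
pose L : distrLatticeType d := HB.pack {classic T} mixin.
exists d, L.
have fD : {morph (id : T -> lattice_semiring L) : x y / x + y} by [].
have fM : {morph (id : T -> lattice_semiring L) : x y / x * y} by [].
by exists (Hom fD fM); exists id.
Qed.

(** * Quotients *)

Section QuotientMaps.
Variables (S : semiring) (rho : S -> S -> Prop) (rhoP : is_congruence rho).

Definition quot_hom : hom S (quot_semiring rhoP) :=
  @Hom S (quot_semiring rhoP) (class_of rhoP) (class_ofD rhoP) (class_ofM rhoP).

Lemma quot_homP x y : quot_hom x = quot_hom y <-> rho x y.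
Proof. exact: class_ofP. Qed.

Lemma quot_hom_surj : surjective quot_hom.
Proof. by move=> u; exists (class_repr u); apply: class_reprK. Qed.

Variables (sigma : S -> S -> Prop) (sigmaP : is_congruence sigma).
Hypothesis rho_sigma : forall x y, rho x y -> sigma x y.

Definition quot_map (u : quot_semiring rhoP) : quot_semiring sigmaP :=
  class_of sigmaP (class_repr u).

Lemma quot_map_class x : quot_map (class_of rhoP x) = class_of sigmaP x.
Proof. by apply/class_ofP/rho_sigma; apply/class_ofP; apply: class_reprK. Qed.

Fact quot_mapD : {morph quot_map : u v / u + v}.
Proof.
move=> u v; have [[x <-] [y <-]] := (quot_hom_surj u, quot_hom_surj v).
by rewrite -homD /= !quot_map_class (class_ofD sigmaP).
Qed.

Fact quot_mapM : {morph quot_map : u v / u * v}.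
Proof.
move=> u v; have [[x <-] [y <-]] := (quot_hom_surj u, quot_hom_surj v).
by rewrite -homM /= !quot_map_class (class_ofM sigmaP).
Qed.

Definition quot_map_hom : hom (quot_semiring rhoP) (quot_semiring sigmaP) :=
  Hom quot_mapD quot_mapM.

Lemma quot_map_surj : surjective quot_map_hom.
Proof.
move=> u; exists (class_of rhoP (class_repr u)).
by rewrite /= quot_map_class class_reprK.
Qed.

End QuotientMaps.
Arguments quot_homP {S rho} rhoP x y.
Arguments quot_hom_surj {S rho} rhoP.

Lemma band_of_surjection (S T : semiring) (f : hom S T) :
  surjective f -> band_semiring S -> band_semiring T.
Proof.
move=> f_surj [[addid mulid] xxy xyx].
split; [split|..] => u; have [x <-] := f_surj u.
- by rewrite -homD addid.
- by rewrite -homM mulid.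
- by move=> v; have [y <-] := f_surj v; rewrite -homM -!homD xxy.
- by move=> v; have [y <-] := f_surj v; rewrite -homM -!homD xyx.
Qed.

Lemma band_of_injection (S T : semiring) (f : hom S T) :
  injective f -> band_semiring T -> band_semiring S.
Proof.
move=> f_inj [[addid mulid] xxy xyx].
split; [split|..] => *; apply: f_inj.
all: by rewrite ?homD ?homM ?addid ?mulid ?xxy ?xyx.
Qed.

(** * Left and right band semirings *)

(** Minimality: in a semilattice quotient, x = x + y + x and y = y + x + y
    become one element. *)
Lemma green_D_least (S : semiring) : band_semiring S ->
  least_distributive_lattice_congruence (@green_D_add S).
Proof.
move=> band; have [idem _ _] := band; have DP := green_D_congruence idem.
split.
  exists DP; have f_surj := quot_hom_surj DP.
  have [Qidem Qxxy Qxyx] := band_of_surjection f_surj band.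
  have QC : commutative (@add (quot_semiring DP)).
    move=> u v; have [[x <-] [y <-]] := (f_surj u, f_surj v).
    by rewrite -!homD; apply/quot_homP/green_D_addC.
  apply: distributive_lattice_of_absorption => // u v.
    by rewrite -[RHS](Qxxy u v) QC -addA (addxx Qidem).
  by rewrite -[RHS](Qxyx u v) QC -addA (addxx Qidem).
move=> sigma [sigmaP [d [L [g /bij_inj g_inj]]]] x y [xy yx].
apply/(quot_homP sigmaP)/g_inj.
rewrite -{1}xy -{2}yx !homD /= (joinC (g (class_of _ y))).
by rewrite joinC joinA joinxx -joinA joinxx.
Qed.

(** Under left regularity x + y + x = x is the same as x + y = x, so L and D
    coincide. *)
Lemma left_band_of_left_regular (S : semiring) : band_semiring S ->
  (forall x y : S, x + y + x = x + y) -> left_band_semiring S.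
Proof.
move=> band reg; have [idem _ _] := band; split=> //.
suff -> : @green_L_add S = @green_D_add S by exact: green_D_least.
apply/funext => x; apply/funext => y; apply/propext; split.
  exact: green_L_sub_D.
by rewrite /green_D_add /absorbs !reg => xy; apply/green_L_addP.
Qed.

Lemma right_band_of_right_regular (S : semiring) : band_semiring S ->
  (forall x y : S, x + y + x = y + x) -> right_band_semiring S.
Proof.
move=> band reg; have [idem _ _] := band; split=> //.
suff -> : @green_R_add S = @green_D_add S by exact: green_D_least.
apply/funext => x; apply/funext => y; apply/propext; split.
  exact: green_R_sub_D.
by rewrite /green_D_add /absorbs !reg => -[yx xy]; apply/green_R_addP.
Qed.

(** Absorption in the quotient makes x + x y and x + y x congruent to x, hence
    D-related to it. *)
Lemma band_of_lattice_congruence_sub_D (S : semiring) (rho : S -> S -> Prop) :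
  idempotent_semiring S -> distributive_lattice_congruence rho ->
  (forall x y, rho x y -> green_D_add x y) -> band_semiring S.
Proof.
move=> idem [rhoP [d [L [g /bij_inj g_inj]]]] rhoD.
have absorb (x z : S) : green_D_add x (x + z) -> absorbs x z.
  by case=> + _; rewrite /absorbs !addA (addxx idem).
split=> // x y; apply/absorb/rhoD/(quot_homP rhoP)/g_inj.
all: rewrite homD homM !(homD, homM) /=.
  by rewrite meetKU.
by rewrite meetC meetKU.
Qed.

Lemma left_band_is_band (S : semiring) :
  left_band_semiring S -> band_semiring S.
Proof.
by case=> idem [LP _]; apply: band_of_lattice_congruence_sub_D LP _ => //;
  apply: green_L_sub_D.
Qed.

Lemma right_band_is_band (S : semiring) :
  right_band_semiring S -> band_semiring S.
Proof.
by case=> idem [RP _]; apply: band_of_lattice_congruence_sub_D RP _ => //;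
  apply: green_R_sub_D.
Qed.

(** * Spined products *)

Lemma band_pullback (S1 S2 T : semiring) (phi1 : hom S1 T) (phi2 : hom S2 T) :
  band_semiring S1 -> band_semiring S2 -> band_semiring (pullback phi1 phi2).
Proof.
move=> [[add1 mul1] xxy1 xyx1] [[add2 mul2] xxy2 xyx2].
split; [split|..] => -[[x1 x2] x12] *; apply: eq_exist.
all: rewrite /= /prod_add /prod_mul /=.
all: by rewrite ?(add1, mul1, xxy1, xyx1) ?(add2, mul2, xxy2, xyx2).
Qed.

Lemma band_spined_product (S : semiring) (band : band_semiring S)
    (RP : is_congruence (@green_R_add S)) (LP : is_congruence (@green_L_add S))
    (DP : is_congruence (@green_D_add S)) :
  spined_product S (quot_semiring RP) (quot_semiring LP) (quot_semiring DP).
Proof.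
have [idem _ _] := band.
have RD := green_R_sub_D idem; have LD := green_L_sub_D idem.
exists (quot_map_hom RP DP RD), (quot_map_hom LP DP LD).
split; [exact: quot_map_surj | exact: quot_map_surj |].
set phi1 := quot_map_hom _ _ _; set phi2 := quot_map_hom _ _ _.
have fP x : in_pullback phi1 phi2 (quot_hom RP x, quot_hom LP x).
  by rewrite /in_pullback /= !quot_map_class.
pose f x : pullback phi1 phi2 := exist _ _ (fP x).
have fD : {morph f : x y / x + y}.
  by move=> x y; apply: eq_exist; rewrite !homD.
have fM : {morph f : x y / x * y}.
  by move=> x y; apply: eq_exist; rewrite !homM.
exists (Hom fD fM).
(* For x D y, x + y is R-related to x and L-related to y. *)
exists (fun p => class_repr (sval p).1 + class_repr (sval p).2).
  move=> x /=.
  set r := class_repr _; set l := class_repr _.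
  have xRr : green_R_add x r by apply/(class_ofP RP); rewrite class_reprK.
  have xLl : green_L_add x l by apply/(class_ofP LP); rewrite class_reprK.
  have [[rx _] [xl _]] :=
    ((green_R_addP idem x r).1 xRr, (green_L_addP idem x l).1 xLl).
  have rDx := green_D_sym (RD _ _ xRr).
  have rDl := green_D_trans idem rDx (LD _ _ xLl).
  by rewrite -(green_D_rectangular idem rDx rDl) rx xl.
move=> [[u v] uv]; apply: eq_exist => /=.
set x := class_repr u; set y := class_repr v.
have [xy yx] : green_D_add x y by apply/(class_ofP DP).
rewrite -[in RHS](class_reprK u) -[in RHS](class_reprK v).
congr (_, _); apply/class_ofP.
  by apply/green_R_addP => //; rewrite (addKl idem) xy.
by apply/green_L_addP => //; rewrite -addA (addxx idem) addA yx.
Qed.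

Theorem theorem3p12 (S : semiring) (S_idem : idempotent_semiring S) :
  band_semiring S <->
  exists S1 S2 T : semiring,
    left_band_semiring S1 /\ right_band_semiring S2 /\
    is_distributive_lattice T /\ spined_product S S1 S2 T.
Proof.
split=> [band | [S1 [S2 [T [lS1 [rS2 [_ [phi1 [phi2 [_ _ [f f_bij]]]]]]]]]]].
  have RP := green_R_congruence band; have LP := green_L_congruence band.
  have [[DP DT] _] := green_D_least band.
  exists (quot_semiring RP), (quot_semiring LP), (quot_semiring DP).
  split; [|split; [|split]] => //; last exact: band_spined_product.
    have surj := quot_hom_surj RP.
    apply: left_band_of_left_regular (band_of_surjection surj band) _ => u v.
    have [[x <-] [y <-]] := (surj u, surj v).
    rewrite -!homD; apply/quot_homP/green_R_addP => //.
    split; first exact: (addKl S_idem).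
    by rewrite -addA (addKl S_idem) (addxx S_idem).
  have surj := quot_hom_surj LP.
  apply: right_band_of_right_regular (band_of_surjection surj band) _ => u v.
  have [[x <-] [y <-]] := (surj u, surj v).
  rewrite -!homD; apply/quot_homP/green_L_addP => //.
  rewrite -(addA x y x); split; first by rewrite -addA (addxx S_idem).
  by rewrite addA -(addA y x x) !(addxx S_idem).
apply: (band_of_injection (bij_inj f_bij)).
exact: band_pullback (left_band_is_band lS1) (right_band_is_band rS2).
Qed.
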